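(* Let $\mathbf U=\langle\langle U,\approx\rangle,\preceq\rangle$ be a completely lattice $\mathbf L$-ordered set. Then the $\mathbf L$-relations $\preceq$ and $\approx$ on $\mathbf U$ are complete.
   Context: $\mathbf L=\langle L,\wedge,\vee,\otimes,\to,0,1\rangle$ is a complete residuated lattice ($\langle L,\wedge,\vee,0,1\rangle$ complete lattice, $\langle L,\otimes,1\rangle$ commutative monoid, $a\otimes b\le c$ iff $a\le b\to c$). An $\mathbf L$-set in $X$ is a map $X\to L$; $L^X$ the set of them; $S(A,B)=\bigwedge_x(A(x)\to B(x))$. An $\mathbf L$-equality is a binary $\mathbf L$-relation that is reflexive, symmetric, transitive ($R(x,y)\otimes R(y,z)\le R(x,z)$) and with $R(x,y)=1\Rightarrow x=y$. An $\mathbf L$-ordered set is $\langle\langle U,\approx\rangle,\preceq\rangle$, $\approx$ an $\mathbf L$-equality, $\preceq$ reflexive, transitive, compatible with $\approx$ ($(u\preceq v)\otimes(u\approx u')\otimes(v\approx v')\le(u'\preceq v')$), and $(u\preceq v)\wedge(v\preceq u)\le u\approx v$. For $V\in L^U$: $\mathcal L V(v)=\bigwedge_u(V(u)\to(v\preceq u))$, $\mathcal U V(v)=\bigwedge_u(V(u)\to(u\preceq v))$; $\inf V$ is the unique $u$ with $\mathcal L V(u)=1=\mathcal U(\mathcal L V)(u)$, $\sup V$ the unique $u$ with $\mathcal U V(u)=1=\mathcal L(\mathcal U V)(u)$; completely lattice means these exist for all $V$. Power relation: for $R$ on $X$ and $A,B\in L^X$, $(R\circ B)(x)=\bigvee_y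 R(x,y)\otimes B(y)$, $(A\circ R)(y)=\bigvee_x A(x)\otimes R(x,y)$, $R^+(A,B)=S(A,R\circ B)\wedge S(B,A\circ R)$. A binary $\mathbf L$-relation $R$ on $\mathbf U$ is complete if it is compatible with $\approx$ (i.e. $R(u,v)\otimes(u\approx u')\otimes(v\approx v')\le R(u',v')$) and for all $V_1,V_2\in L^U$, $R^+(V_1,V_2)\le R(\inf V_1,\inf V_2)$ and $R^+(V_1,V_2)\le R(\sup V_1,\sup V_2)$. *)

(* Defs.v *)
From HB Require Import structures.
From mathcomp Require Import all_boot all_order.
From mathcomp Require Import boolp classical_sets.

Set Implicit Arguments.
Unset Strict Implicit.
Unset Printing Implicit Defensive.

Import Order.TTheory.
Local Open Scope order_scope.

HB.mixin Record isCompleteResiduated d L of Order.TBLattice d L := {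
  supremums_neq0 : forall A : set L, (supremums A !=set0)%classic ;
  infimums_neq0 : forall A : set L, (infimums A !=set0)%classic ;
  tensor : L -> L -> L ;
  residuum : L -> L -> L ;
  tensorA : associative tensor ;
  tensorC : commutative tensor ;
  tensor1 : left_id \top tensor ;
  tensor_residuum : forall a b c : L, (tensor a b <= c) = (a <= residuum b c)
}.

#[short(type="completeResiduatedLatticeType")]
HB.structure Definition CompleteResiduatedLattice d :=
  { L of isCompleteResiduated d L & Order.TBLattice d L }.

Arguments tensor {d s} : rename.
Arguments residuum {d s} : rename.

Notation "a ⊗ b" := (tensor a b) (at level 40, left associativity).
Notation "a ⇒ b" := (residuum a b) (at level 70, right associativity).

Section LSets.
Context {d : Order.disp_t} {L : completeResiduatedLatticeType d}.

(* [supremum x0] and [infimum x0] return [x0] on the empty set, so the defaults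
   below give the correct values when [I] is empty. *)
Definition bigvee (I : Type) (f : I -> L) : L := supremum \bot (range f)%classic.
Definition bigwedge (I : Type) (f : I -> L) : L := infimum \top (range f)%classic.

Definition subsethood (X : Type) (A B : X -> L) : L :=
  bigwedge (fun x => A x ⇒ B x).

Record L_equality (X : Type) (R : X -> X -> L) : Prop := {
  L_eq_refl : forall x, R x x = \top ;
  L_eq_sym : forall x y, R x y = R y x ;
  L_eq_trans : forall x y z, R x y ⊗ R y z <= R x z ;
  L_eq_sep : forall x y, R x y = \top -> x = y
}.

Definition compatible (X : Type) (E R : X -> X -> L) : Prop :=
  forall u u' v v', R u v ⊗ E u u' ⊗ E v v' <= R u' v'.

Record L_order (X : Type) (E R : X -> X -> L) : Prop := {
  L_order_refl : forall u, R u u = \top ;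
  L_order_trans : forall u v w, R u v ⊗ R v w <= R u w ;
  L_order_compat : compatible E R ;
  L_order_antisym : forall u v, R u v `&` R v u <= E u v
}.

Definition rel_apply (X : Type) (R : X -> X -> L) (B : X -> L) (x : X) : L :=
  bigvee (fun y => R x y ⊗ B y).
Definition apply_rel (X : Type) (A : X -> L) (R : X -> X -> L) (y : X) : L :=
  bigvee (fun x => A x ⊗ R x y).

Definition power_rel (X : Type) (R : X -> X -> L) (A B : X -> L) : L :=
  subsethood A (rel_apply R B) `&` subsethood B (apply_rel A R).

End LSets.

Record lordset d (L : completeResiduatedLatticeType d) := LOrdSet {
  lcarrier :> Type ;
  leqv : lcarrier -> lcarrier -> L ;
  lle : lcarrier -> lcarrier -> L ;
  leqv_equality : L_equality leqv ;
  lle_order : L_order leqv lle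
}.
Arguments leqv {d L} l.
Arguments lle {d L} l.

Section CompleteLattice.
Context {d : Order.disp_t} {L : completeResiduatedLatticeType d}.
Context {U : lordset L}.

Definition lower_cone (V : U -> L) (v : U) : L :=
  bigwedge (fun u => V u ⇒ lle U v u).
Definition upper_cone (V : U -> L) (v : U) : L :=
  bigwedge (fun u => V u ⇒ lle U u v).

Definition is_inf (V : U -> L) (u : U) : Prop :=
  lower_cone V u = \top /\ upper_cone (lower_cone V) u = \top.
Definition is_sup (V : U -> L) (u : U) : Prop :=
  upper_cone V u = \top /\ lower_cone (upper_cone V) u = \top.

Lemma bigwedge_le (I : Type) (f : I -> L) i : bigwedge f <= f i.
Proof.
have [x fx] := infimums_neq0 (range f)%classic.
rewrite /bigwedge /infimum; case: ifPn => [/eqP f0|_].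
  by have : set0 (f i) by rewrite -f0; exists i.
by case: xgetP => [y _ [fy _]|/(_ x)//]; apply: fy; exists i.
Qed.

Lemma residuum_top_le (a b : L) : \top <= (a ⇒ b) -> a <= b.
Proof. by rewrite -tensor_residuum tensor1. Qed.

Lemma lle_antisym (u v : U) : lle U u v = \top -> lle U v u = \top -> u = v.
Proof.
move=> uv vu; apply: (L_eq_sep (leqv_equality U)); apply/eqP; rewrite -le1x.
by apply: le_trans (L_order_antisym (lle_order U) u v); rewrite uv vu meetxx.
Qed.

Lemma is_inf_unique (V : U -> L) (u v : U) : is_inf V u -> is_inf V v -> u = v.
Proof.
have le_inf x y : is_inf V x -> is_inf V y -> lle U x y = \top.
  move=> [x1 _] [_ y2]; apply/eqP; rewrite -le1x -x1; apply: residuum_top_le.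
  by rewrite -y2; exact: (bigwedge_le (fun u => lower_cone V u ⇒ lle U u y) x).
by move=> iu iv; apply: lle_antisym; apply: le_inf.
Qed.

Lemma is_sup_unique (V : U -> L) (u v : U) : is_sup V u -> is_sup V v -> u = v.
Proof.
have le_sup x y : is_sup V x -> is_sup V y -> lle U x y = \top.
  move=> [_ x2] [y1 _]; apply/eqP; rewrite -le1x -y1; apply: residuum_top_le.
  by rewrite -x2; exact: (bigwedge_le (fun u => upper_cone V u ⇒ lle U x u) y).
by move=> su sv; apply: lle_antisym; apply: le_sup.
Qed.

End CompleteLattice.

Definition completely_lattice d (L : completeResiduatedLatticeType d)
    (U : lordset L) : Prop :=
  forall V : U -> L, (exists u, is_inf V u) /\ (exists u, is_sup V u).

Section CompleteRelation.
Context {d : Order.disp_t} {L : completeResiduatedLatticeType d}.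
Context {U : lordset L} (cU : completely_lattice U).

(* The choice is immaterial by [is_inf_unique] and [is_sup_unique]. *)
Definition linf (V : U -> L) : U := projT1 (cid (cU V).1).
Definition lsup (V : U -> L) : U := projT1 (cid (cU V).2).

Lemma linfP (V : U -> L) : is_inf V (linf V).
Proof. exact: projT2 (cid (cU V).1). Qed.

Lemma lsupP (V : U -> L) : is_sup V (lsup V).
Proof. exact: projT2 (cid (cU V).2). Qed.

Record complete_rel (R : U -> U -> L) : Prop := {
  complete_compat : compatible (leqv U) R ;
  complete_inf : forall V1 V2 : U -> L,
    power_rel R V1 V2 <= R (linf V1) (linf V2) ;
  complete_sup : forall V1 V2 : U -> L,
    power_rel R V1 V2 <= R (lsup V1) (lsup V2)
}.

End CompleteRelation.

(* Main.v *)
(* Writing [p] for the value of the power relation, [V1 x ⊗ (x ⪯ y) ≤ (inf V1 ⪯ y)]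
   makes [p] a lower bound of [lower_cone V2 (inf V1)], which is at most
   [inf V1 ⪯ inf V2]; suprema are dual. The case of [≈] reduces to that of [⪯],
   because [≈] is symmetric, contained in [⪯], and contains the meet of [⪯] and
   its converse. *)
Require Import Defs.
From mathcomp Require Import all_boot all_order.
From mathcomp Require Import boolp classical_sets.

Set Implicit Arguments.
Unset Strict Implicit.
Unset Printing Implicit Defensive.

Import Order.TTheory.
Local Open Scope order_scope.

Section ResiduatedLattice.
Context {d : Order.disp_t} {L : completeResiduatedLatticeType d}.

Lemma le_residuum (a b : L) : (\top <= (a ⇒ b)) = (a <= b).
Proof. by rewrite -tensor_residuum tensor1. Qed.

(** Monotonicity is not an axiom; it comes from adjointness through the unit [b <= (c ⇒ b ⊗ c)]. *)
Lemma le_tensor2r (c a b : L) : a <= b -> a ⊗ c <= b ⊗ c.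
Proof.
by move=> ab; rewrite tensor_residuum; apply: le_trans ab _; rewrite -tensor_residuum.
Qed.

Lemma le_tensor2l (c a b : L) : a <= b -> c ⊗ a <= c ⊗ b.
Proof. by rewrite ![c ⊗ _]tensorC; apply: le_tensor2r. Qed.

Lemma le_bigwedge (I : Type) (f : I -> L) c :
  (forall i, c <= f i) -> c <= bigwedge f.
Proof.
move=> cf; have [x fx] := infimums_neq0 (range f)%classic.
(* For an empty index type [infimum] returns its default [\top], the correct empty meet. *)
rewrite /bigwedge /infimum; case: ifPn => [_|_]; first exact: lex1.
case: xgetP => [y _ [_ ymax]|/(_ x)//].
by apply: ymax => _ [i _ <-]; exact: cf.
Qed.

Lemma le_bigvee (I : Type) (f : I -> L) i : f i <= bigvee f.
Proof.
have [x fx] := supremums_neq0 (range f)%classic.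
rewrite /bigvee /supremum; case: ifPn => [/eqP f0|_].
  by have : set0 (f i) by rewrite -f0; exists i.
by case: xgetP => [y _ [fy _]|/(_ x)//]; apply: fy; exists i.
Qed.

Lemma bigvee_le (I : Type) (f : I -> L) c :
  (forall i, f i <= c) -> bigvee f <= c.
Proof.
move=> fc; have [x fx] := supremums_neq0 (range f)%classic.
rewrite /bigvee /supremum; case: ifPn => [_|_]; first exact: le0x.
case: xgetP => [y _ [_ ymin]|/(_ x)//].
by apply: ymin => _ [i _ <-]; exact: fc.
Qed.

Lemma subsethood_eval (X : Type) (A B : X -> L) x : subsethood A B ⊗ A x <= B x.
Proof. by rewrite tensor_residuum; apply: (bigwedge_le (fun x => A x ⇒ B x)). Qed.

Lemma subsethood_mono (X : Type) (A B C : X -> L) :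
  (forall x, B x <= C x) -> subsethood A B <= subsethood A C.
Proof.
move=> BC; apply: le_bigwedge => x; rewrite -tensor_residuum.
exact: le_trans (subsethood_eval A B x) (BC x).
Qed.

Lemma power_rel_mono (X : Type) (R S : X -> X -> L) (A B : X -> L) :
  (forall x y, R x y <= S x y) -> power_rel R A B <= power_rel S A B.
Proof.
move=> RS; apply: leI2; apply: subsethood_mono => x; apply: bigvee_le => y.
  apply: le_trans (le_tensor2r _ (RS x y)) _.
  exact: (le_bigvee (fun y => S x y ⊗ B y)).
apply: le_trans (le_tensor2l _ (RS y x)) _.
exact: (le_bigvee (fun y => A y ⊗ S y x)).
Qed.

(** For symmetric [R] the images [rel_apply R C] and [apply_rel C R] coincide, so exchanging [A] and
    [B] only exchanges the two sides of the meet. *)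
Lemma power_rel_sym (X : Type) (R : X -> X -> L) (A B : X -> L) :
  (forall x y, R x y = R y x) -> power_rel R A B = power_rel R B A.
Proof.
move=> Rsym; have app C : rel_apply R C = apply_rel C R.
  by apply: funext => x; congr bigvee; apply: funext => y; rewrite tensorC Rsym.
by rewrite /power_rel !app meetC.
Qed.

End ResiduatedLattice.

Section LOrderedSet.
Context {d : Order.disp_t} {L : completeResiduatedLatticeType d}.
Context {U : lordset L}.
Implicit Types (V : U -> L) (u v w : U).

Lemma leqv_compat : compatible (leqv U) (leqv U).
Proof.
have E := leqv_equality U; move=> u u' v v'.
(* Reordering gives the chain [u' ≈ u ≈ v ≈ v'], to which transitivity applies twice. *)
rewrite [leqv U u v ⊗ _]tensorC (L_eq_sym E u).
exact: le_trans (le_tensor2r _ (L_eq_trans E u' u v)) (L_eq_trans E u' v v').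
Qed.

Lemma leqv_lle u v : leqv U u v <= lle U u v.
Proof.
(* Compatibility moves the right end of [u ⪯ u], which has degree [\top], along [u ≈ v]. *)
have := L_order_compat (lle_order U) u u u v.
by rewrite (L_order_refl (lle_order U)) (L_eq_refl (leqv_equality U)) !tensor1.
Qed.

Lemma inf_le V u v : is_inf V u -> V v <= lle U u v.
Proof.
move=> [uV _]; rewrite -le_residuum -uV.
exact: (bigwedge_le (fun v => V v ⇒ lle U u v)).
Qed.

(** The graded form of being the greatest lower bound: [v] may be a lower bound of [V] only to some
    degree. *)
Lemma lower_cone_le_inf V u v : is_inf V u -> lower_cone V v <= lle U v u.
Proof.
move=> [_ uV]; rewrite -le_residuum -uV.
exact: (bigwedge_le (fun v => lower_cone V v ⇒ lle U v u)).
Qed.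

Lemma le_sup V u v : is_sup V u -> V v <= lle U v u.
Proof.
move=> [uV _]; rewrite -le_residuum -uV.
exact: (bigwedge_le (fun v => V v ⇒ lle U v u)).
Qed.

Lemma upper_cone_sup_le V u v : is_sup V u -> upper_cone V v <= lle U u v.
Proof.
move=> [_ uV]; rewrite -le_residuum -uV.
exact: (bigwedge_le (fun v => upper_cone V v ⇒ lle U u v)).
Qed.

Lemma power_lle_inf V1 V2 u1 u2 : is_inf V1 u1 -> is_inf V2 u2 ->
  power_rel (lle U) V1 V2 <= lle U u1 u2.
Proof.
move=> i1 i2; apply: le_trans (lower_cone_le_inf u1 i2).
apply: le_bigwedge => y; rewrite -tensor_residuum.
(* Only the second half of the meet is kept: each [y] in [V2] lies above some [x] in [V1], in the
   graded sense. *)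
apply: le_trans (le_tensor2r _ (leIr _ _)) _.
apply: le_trans (subsethood_eval _ _ _) _; apply: bigvee_le => x.
apply: le_trans (le_tensor2r _ (inf_le x i1)) _.
exact: (L_order_trans (lle_order U)).
Qed.

Lemma power_lle_sup V1 V2 u1 u2 : is_sup V1 u1 -> is_sup V2 u2 ->
  power_rel (lle U) V1 V2 <= lle U u1 u2.
Proof.
move=> s1 s2; apply: le_trans (upper_cone_sup_le u2 s1).
apply: le_bigwedge => x; rewrite -tensor_residuum.
(* Dually, the first half is kept: each [x] in [V1] lies below some [y] in [V2]. *)
apply: le_trans (le_tensor2r _ (leIl _ _)) _.
apply: le_trans (subsethood_eval _ _ _) _; apply: bigvee_le => y.
apply: le_trans (le_tensor2l _ (le_sup y s2)) _.
exact: (L_order_trans (lle_order U)).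
Qed.

(** Leaving [u1] and [u2] arbitrary lets one argument serve both infima and suprema. *)
Lemma power_leqv_le V1 V2 u1 u2 :
    power_rel (lle U) V1 V2 <= lle U u1 u2 ->
    power_rel (lle U) V2 V1 <= lle U u2 u1 ->
  power_rel (leqv U) V1 V2 <= leqv U u1 u2.
Proof.
move=> le12 le21; apply: le_trans (L_order_antisym (lle_order U) u1 u2).
rewrite lexI; apply/andP; split.
  exact: le_trans (power_rel_mono _ _ leqv_lle) le12.
(* The swap must precede the passage to [⪯], since it relies on the symmetry of [≈]. *)
rewrite (power_rel_sym _ _ (L_eq_sym (leqv_equality U))).
exact: le_trans (power_rel_mono _ _ leqv_lle) le21.
Qed.

End LOrderedSet.

Theorem theorem9 (d : Order.disp_t) (L : completeResiduatedLatticeType d)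
    (U : lordset L) (cU : completely_lattice U) :
  complete_rel cU (lle U) /\ complete_rel cU (leqv U).
Proof.
split; split.
- exact: L_order_compat (lle_order U).
- by move=> V1 V2; apply: power_lle_inf; apply: linfP.
- by move=> V1 V2; apply: power_lle_sup; apply: lsupP.
- exact: leqv_compat.
- by move=> V1 V2; apply: power_leqv_le; apply: power_lle_inf; apply: linfP.
- by move=> V1 V2; apply: power_leqv_le; apply: power_lle_sup; apply: lsupP.
Qed.
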